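(* Assume that $\bar{\mathcal P}$ is Archimedean, and fix $\delta>0$. For $d\in\mathbb{N}$ consider the degree-$2d$ program: find $v\in\mathbb{R}^n$ with $v_i>0$ for all $i$, $S\in\mathbb{R}^{m\times n}$, and polynomials $M_{ij}\in\mathbb{R}[A,B]_{\le 2d}$ ($i,j=1,\dots,n$) such that $$v_i-\delta-\sum_{j=1}^nM_{ij}(A,B)\in\Sigma[\bar{\mathcal P}]_{\le2d}\quad (i=1,\dots,n),$$ $$M_{ij}(A,B)\pm\Big(A_{ij}v_j+\sum_{\ell=1}^mB_{i\ell}S_{\ell j}\Big)\in\Sigma[\bar{\mathcal P}]_{\le2d}\quad (i,j=1,\dots,n,\ \text{both signs}).$$ This program recovers an (extended) superstabilizing controller, if one exists, as $d\to\infty$. That is: for every $d$, any feasible solution yields $K=S\,\mathrm{diag}(v)^{-1}$ such that $\|\mathrm{diag}(v)^{-1}(A+BK)\,\mathrm{diag}(v)\|_\infty<1$ for all $(A,B)\in\mathcal P$; and if there exist $v\in\mathbb{R}^n$ with positive entries and $K\in\mathbb{R}^{m\times n}$ such that $\|\mathrm{diag}(v)^{-1}(A+BK)\,\mathrm{diag}(v)\|_\infty<1$ for all $(A,B)\in\mathcal P$, then the degree-$2d$ program is feasible for all sufficiently large $d$.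
   Context: Data: integers $n,m\ge1$, $T\ge2$, a noise bound $\epsilon\ge0$, and recorded vectors $\hat x_t\in\mathbb{R}^n$ ($t=1,\dots,T$), $u_t\in\mathbb{R}^m$ ($t=1,\dots,T-1$). For $A\in\mathbb{R}^{n\times n}$, $B\in\mathbb{R}^{n\times m}$ put $h^0_t=\hat x_{t+1}-A\hat x_t-Bu_t$ for $t=1,\dots,T-1$. The consistency set $\bar{\mathcal P}\subset\mathbb{R}^{n\times n}\times\mathbb{R}^{n\times m}\times\mathbb{R}^{n\times T}$ is the set of all $(A,B,\Delta x)$, with $\Delta x=(\Delta x_1,\dots,\Delta x_T)$, such that $0=-\Delta x_{t+1}+A\Delta x_t+h^0_t$ for $t=1,\dots,T-1$ and $\|\Delta x_t\|_\infty\le\epsilon$ for $t=1,\dots,T$. It is regarded as described by the polynomial equalities $(-\Delta x_{t+1}+A\Delta x_t+h^0_t)_i=0$ and the inequalities $\epsilon-\Delta x_{ti}\ge0$, $\epsilon+\Delta x_{ti}\ge0$, where $\Delta x_{ti}$ is the $i$-th entry of $\Delta x_t$. The set $\mathcal P$ of consistent plants is the projection of $\bar{\mathcal P}$ onto the $(A,B)$ coordinates. For a matrix $N$, $\|N\|_\infty=\max_i\sum_j|N_{ij}|$. For a set $\mathbb{K}$ described by polynomial inequalities $g_i(x)\ge0$ and equalities $h_j(x)=0$, $\Sigma[\mathbb{K}]$ is the set of polynomials of the form $\sigma_0+\sum_i\sigma_ig_i+\sum_j\phi_jh_j$ with $\sigma_0,\sigma_i$ sums of squares of polynomials in $x$ and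 $\phi_j$ arbitrary polynomials in $x$; $\Sigma[\mathbb{K}]_{\le2d}$ is the subset for which such a representation exists with $\sigma_0$, every $\sigma_ig_i$ and every $\phi_jh_j$ of degree at most $2d$. $\mathbb{K}$ is Archimedean if $R-\|x\|_2^2\in\Sigma[\mathbb{K}]$ for some $R>0$. Here $x=(A,B,\Delta x)$. $\mathbb{R}[A,B]_{\le2d}$ denotes polynomials in the entries of $(A,B)$ of degree at most $2d$. *)

(* Defs.v *)
From HB Require Import structures.
From mathcomp Require Import all_boot all_order all_algebra.
From mathcomp Require Import reals.
From mathcomp Require Import mpoly.

Set Implicit Arguments.
Unset Strict Implicit.
Unset Printing Implicit Defensive.

Import Order.TTheory GRing.Theory Num.Theory.

Local Open Scope ring_scope.

(* On a column vector this is the sup norm. *)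
Definition mx_infnorm (R : realType) (p q : nat) (N : 'M[R]_(p, q)) : R :=
  \big[Num.max/0]_i \sum_j `|N i j|.

Section QuadraticModule.
Variables (R : realType) (k : nat) (I J : finType).
Variables (g : I -> {mpoly R[k]}) (h : J -> {mpoly R[k]}).

Definition sos (p : {mpoly R[k]}) : Prop :=
  exists s : seq {mpoly R[k]}, p = \sum_(q <- s) q ^+ 2.

(* [msize] is degree + 1, and [msize 0 = 0]. *)
Definition mdeg_le (e : nat) (p : {mpoly R[k]}) : bool := (msize p <= e.+1)%N.

Definition quad_module (p : {mpoly R[k]}) : Prop :=
  exists (s0 : {mpoly R[k]}) (s : I -> {mpoly R[k]}) (f : J -> {mpoly R[k]}),
    [/\ sos s0, forall i, sos (s i)
      & p = s0 + \sum_i s i * g i + \sum_j f j * h j].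

Definition quad_module_le (e : nat) (p : {mpoly R[k]}) : Prop :=
  exists (s0 : {mpoly R[k]}) (s : I -> {mpoly R[k]}) (f : J -> {mpoly R[k]}),
    [/\ sos s0, forall i, sos (s i),
        p = s0 + \sum_i s i * g i + \sum_j f j * h j
      & [/\ mdeg_le e s0, forall i, mdeg_le e (s i * g i)
          & forall j, mdeg_le e (f j * h j)]].

Definition archimedean_module : Prop :=
  exists2 r : R, 0 < r & quad_module (r%:MP - \sum_(i < k) 'X_i ^+ 2).

End QuadraticModule.

(* Time instants 1, ..., T are 'I_T, and the transitions t -> t + 1 are indexed
   by 'I_T.-1. *)
Definition ord_from (T : nat) (t : 'I_T.-1) : 'I_T := widen_ord (leq_pred T) t.

Lemma ord_to_subproof (T : nat) (t : 'I_T.-1) : (t.+1 < T)%N.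
Proof. by case: T t => [[]|T t] //; exact: (ltn_ord t). Qed.

Definition ord_to (T : nat) (t : 'I_T.-1) : 'I_T := Ordinal (ord_to_subproof t).

(* Stated over any commutative ring so as to apply both to numerical matrices
   and to matrices of indeterminates. *)
Section Residual.
Variables (S : comNzRingType) (n m T : nat).
Variables (xh : 'M[S]_(n, T)) (u : 'M[S]_(m, T.-1)).

Definition residual0 (A : 'M[S]_n) (B : 'M[S]_(n, m)) (t : 'I_T.-1) : 'cV[S]_n :=
  col (ord_to t) xh - A *m col (ord_from t) xh - B *m col t u.

Definition residual (A : 'M[S]_n) (B : 'M[S]_(n, m)) (Dx : 'M[S]_(n, T))
    (t : 'I_T.-1) : 'cV[S]_n :=
  - col (ord_to t) Dx + A *m col (ord_from t) Dx + residual0 A B t.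

End Residual.

Section Consistency.
Variables (R : realType) (n m T : nat) (eps : R).
Variables (xh : 'M[R]_(n, T)) (u : 'M[R]_(m, T.-1)).

Definition consistent_ext (A : 'M[R]_n) (B : 'M[R]_(n, m)) (Dx : 'M[R]_(n, T))
    : Prop :=
  (forall t : 'I_T.-1, residual xh u A B Dx t = 0) /\
  (forall t : 'I_T, mx_infnorm (col t Dx) <= eps).

Definition consistent (A : 'M[R]_n) (B : 'M[R]_(n, m)) : Prop :=
  exists Dx : 'M[R]_(n, T), consistent_ext A B Dx.

End Consistency.

(* The indeterminates are the entries of (A, B, Dx), in this order. *)
Notation dimAB n m := (n * n + n * m)%N.
Notation dimABx n m T := (dimAB n m + n * T)%N.

Section Polynomials.
Variables (R : realType) (n m T : nat).
Local Notation poly_AB := {mpoly R[dimAB n m]}.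
Local Notation poly_ABx := {mpoly R[dimABx n m T]}.

Definition embed_AB (p : poly_AB) : poly_ABx :=
  p \mPo [tuple 'X_(lshift (n * T) i) | i < dimAB n m].

Definition varA : 'M[poly_AB]_n :=
  \matrix_(i, j) 'X_(lshift (n * m) (mxvec_index i j)).

Definition varB : 'M[poly_AB]_(n, m) :=
  \matrix_(i, j) 'X_(rshift (n * n) (mxvec_index i j)).

Definition varDx : 'M[poly_ABx]_(n, T) :=
  \matrix_(i, t) 'X_(rshift (dimAB n m) (mxvec_index i t)).

Variables (eps : R) (xh : 'M[R]_(n, T)) (u : 'M[R]_(m, T.-1)).

Definition cons_ineq (c : 'I_T * 'I_n * bool) : poly_ABx :=
  let: (t, i, b) := c in
  if b then eps%:MP - varDx i t else eps%:MP + varDx i t.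

Definition cons_eq (c : 'I_T.-1 * 'I_n) : poly_ABx :=
  residual (map_mx (@mpolyC _ R) xh) (map_mx (@mpolyC _ R) u)
    (map_mx embed_AB varA) (map_mx embed_AB varB) varDx c.1 c.2 0.

Definition Sigma_cons_le : nat -> poly_ABx -> Prop :=
  quad_module_le cons_ineq cons_eq.

Definition archimedean_cons : Prop := archimedean_module cons_ineq cons_eq.

Definition program_feasible (delta : R) (d : nat)
    (v : 'rV[R]_n) (S : 'M[R]_(m, n)) (M : 'M[poly_AB]_n) : Prop :=
  let Y i j : poly_AB :=
    varA i j * (v 0 j)%:MP + \sum_l varB i l * (S l j)%:MP in
  [/\ forall i, 0 < v 0 i,
      forall i j, mdeg_le (2 * d) (M i j),
      forall i, Sigma_cons_le (2 * d)
        (embed_AB ((v 0 i)%:MP - delta%:MP - \sum_j M i j)),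
      forall i j, Sigma_cons_le (2 * d) (embed_AB (M i j + Y i j))
    & forall i j, Sigma_cons_le (2 * d) (embed_AB (M i j - Y i j))].

End Polynomials.

Definition ext_superstable (R : realType) (n m : nat) (v : 'rV[R]_n)
    (K : 'M[R]_(m, n)) (A : 'M[R]_n) (B : 'M[R]_(n, m)) : Prop :=
  mx_infnorm (invmx (diag_mx v) *m (A + B *m K) *m diag_mx v) < 1.

(* Main.v *)
(** If a feasible solution is evaluated at a consistent plant, the elements of
    the quadratic module become nonnegative, so [M_ij >= |Y_ij|] with
    [Y = A diag(v) + B S], and the rows of [|Y|] sum to at most [v_i - delta].

    Conversely, with [S = K diag(v)] the functions [v_i - sum_j |Y_ij|] are
    positive on the consistency set, hence bounded below by some [e > 0].
    The [Y_ij] are bounded there, so [|Y_ij|] lies below a polynomial [M_ij] in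
    [Y_ij] that exceeds it by at most [e / 2n].  Scaling [v], [S] and [M] by
    [4 delta / e] makes all the polynomials of the program positive on the
    consistency set, and Putinar's Positivstellensatz puts them in the quadratic
    module, in some finite degree.

    Putinar's theorem for an Archimedean module [Q] goes as follows.  If [-1] is
    not in [Q - f Sigma], a maximal proper quadratic module containing it is
    total, and reading off the real value of each polynomial modulo
    infinitesimals gives a point where [Q] is nonnegative and [f <= 0].
    Otherwise [s f - 1] is in [Q] for a sum of squares [s], from which [f - e] is
    in [Q] for some [e > 0]; this strict form also supplies the margins above
    without any topology. *)

Require Import Defs.
From mathcomp Require Import all_boot all_order all_algebra.
From mathcomp Require Import ring lra.
From mathcomp Require Import boolp classical_sets reals mpoly.
Import Order.TTheory GRing.Theory Num.Theory.

Set Implicit Arguments.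
Unset Strict Implicit.
Unset Printing Implicit Defensive.

Local Open Scope ring_scope.

(** * Archimedean quadratic modules *)

Section QuadraticModules.
Variables (R : realType) (A : comAlgType R).
Implicit Types (Q N : A -> Prop) (a b f s : A) (r : R).

Definition sumsq a := exists l : seq A, a = \sum_(q <- l) q ^+ 2.

(** The axiomatic form, unlike a presentation by generators, also covers the maximal modules
    produced by Zorn's lemma. *)
Record qmodule Q : Prop := QModule {
  qmodule1 : Q 1;
  qmoduleD : forall a b, Q a -> Q b -> Q (a + b);
  qmodule_sqM : forall a b, Q b -> Q (a ^+ 2 * b) }.

Definition qarchimedean Q := forall a, exists r, Q (r%:A - a).

Definition qbounded Q a := exists2 r, Q (r%:A - a) & Q (r%:A + a).

Definition adjoin Q f a := exists q s, [/\ Q q, sumsq s & a = q + s * f].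

(** Unital homomorphisms of real algebras; on a polynomial ring they are the evaluations at
    points. *)
Record real_point (phi : A -> R) : Prop := RealPoint {
  real_pointD : {morph phi : a b / a + b};
  real_pointM : {morph phi : a b / a * b};
  real_pointA : forall r, phi r%:A = r }.

Lemma alg_morphE :
  ((forall r (n : nat), (r ^+ n)%:A = r%:A ^+ n :> A)%R *
   (forall r t, (r * t)%:A = r%:A * t%:A :> A)%R *
   (forall n : nat, n%:R%:A = n%:R :> A)%R)%type.
Proof.
do !split=> *; [exact: (rmorphXn (in_alg A)) | exact: (rmorphM (in_alg A)) |].
exact: scaler_nat.
Qed.

Lemma sumsq0 : sumsq 0.
Proof. by exists [::]; rewrite big_nil. Qed.

Lemma sumsq_sq a : sumsq (a ^+ 2).
Proof. by exists [:: a]; rewrite big_seq1. Qed.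

Lemma sumsqD a b : sumsq a -> sumsq b -> sumsq (a + b).
Proof. by move=> [l ->] [l' ->]; exists (l ++ l'); rewrite big_cat. Qed.

Lemma sumsq_sqM a b : sumsq b -> sumsq (a ^+ 2 * b).
Proof.
move=> [l ->]; exists [seq a * q | q <- l]; rewrite big_map mulr_sumr.
by apply: eq_bigr => q _; rewrite exprMn.
Qed.

(** * Closure properties and bounded elements of a quadratic module *)

Section Closure.
Variable Q : A -> Prop.
Hypothesis Qmod : qmodule Q.

Lemma qmodule_sq a : Q (a ^+ 2).
Proof. by rewrite -[_ ^+ 2]mulr1; apply: qmodule_sqM => //; case: Qmod. Qed.

Lemma qmodule0 : Q 0.
Proof. by have := qmodule_sq 0; rewrite expr0n. Qed.

Lemma qmodule_scal r a : 0 <= r -> Q a -> Q (r%:A * a).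
Proof.
move=> r0 Qa; rewrite -(sqr_sqrtr r0) (_ : _%:A = (Num.sqrt r)%:A ^+ 2).
  exact: qmodule_sqM.
by rewrite exprZn expr1n.
Qed.

Lemma qmodule_unscal r a : 0 < r -> Q (r%:A * a) -> Q a.
Proof.
move=> r0 /(@qmodule_scal r^-1); rewrite invr_ge0 ltW // => /(_ isT).
by rewrite !mulr_algl scalerA mulVf ?scale1r // gt_eqF.
Qed.

Lemma qmodule_const r : 0 <= r -> Q r%:A.
Proof. by move=> r0; rewrite -[_%:A]mulr1; apply: qmodule_scal (qmodule1 _). Qed.

Lemma qmodule_addC r r' a : r <= r' -> Q (r%:A + a) -> Q (r'%:A + a).
Proof.
move=> le_rr' Qa; rewrite -(subrK r r') scalerDl -addrA.
by apply: qmoduleD => //; apply: qmodule_const; rewrite subr_ge0.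
Qed.

Lemma qmodule_sumsqM a b : sumsq a -> Q b -> Q (a * b).
Proof.
move=> [l ->] Qb; rewrite mulr_suml; apply: (big_ind Q) => //.
- exact: qmodule0.
- exact: qmoduleD.
- by move=> q _; apply: qmodule_sqM.
Qed.

Lemma qmodule_sumsq a : sumsq a -> Q a.
Proof.
by move=> /qmodule_sumsqM/(_ (qmodule1 Qmod)); rewrite mulr1.
Qed.

Lemma adjoin_qmodule f : qmodule (adjoin Q f).
Proof.
split.
- exists 1, 0; split; [exact: qmodule1 | exact: sumsq0 |].
  by rewrite mul0r addr0.
- move=> _ _ [q [s [Qq ss ->]]] [q' [s' [Qq' ss' ->]]].
  exists (q + q'), (s + s'); split; [exact: qmoduleD | exact: sumsqD |].
  by rewrite mulrDl addrACA.
- move=> a _ [q [s [Qq ss ->]]].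
  exists (a ^+ 2 * q), (a ^+ 2 * s); split.
  + exact: qmodule_sqM.
  + exact: sumsq_sqM.
  + by rewrite mulrDr mulrA.
Qed.

Lemma sub_adjoin f a : Q a -> adjoin Q f a.
Proof.
by move=> Qa; exists a, 0; split=> //; [exact: sumsq0 | rewrite mul0r addr0].
Qed.

Lemma mem_adjoin f : adjoin Q f f.
Proof.
exists 0, (1 ^+ 2); split; [exact: qmodule0 | exact: sumsq_sq |].
by rewrite expr1n mul1r add0r.
Qed.

Lemma qbounded_const r : qbounded Q r%:A.
Proof.
exists `|r|; rewrite -?scalerBl -?scalerDl; apply: qmodule_const.
  by rewrite subr_ge0 ler_norm.
by rewrite -[X in _ + X]opprK subr_ge0 -normrN ler_norm.
Qed.

Lemma qboundedD a b : qbounded Q a -> qbounded Q b -> qbounded Q (a + b).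
Proof.
move=> [r Qr Qr'] [t Qt Qt']; exists (r + t).
  by rewrite scalerDl opprD addrACA; apply: qmoduleD.
by rewrite scalerDl addrACA; apply: qmoduleD.
Qed.

Lemma qboundedN a : qbounded Q a -> qbounded Q (- a).
Proof. by move=> [r Qr Qr']; exists r; rewrite ?opprK. Qed.

(** A quadratic module need not be closed under products, so [r - a] and [r + a] are combined
    through [2r(r^2 - a^2) = (r - a)^2 (r + a) + (r + a)^2 (r - a)]. *)
Lemma qmodule_subr_sqr r a :
  0 < r -> Q (r%:A - a) -> Q (r%:A + a) -> Q ((r ^+ 2)%:A - a ^+ 2).
Proof.
move=> r0 Qm Qp; apply: (@qmodule_unscal (2 * r)); first by rewrite mulr_gt0.
rewrite (_ : _ * _ = (r%:A - a) ^+ 2 * (r%:A + a) +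
                     (r%:A + a) ^+ 2 * (r%:A - a)).
  by apply: qmoduleD => //; apply: qmodule_sqM.
rewrite !alg_morphE; ring.
Qed.

Lemma qbounded_sq a : qbounded Q a -> qbounded Q (a ^+ 2).
Proof.
move=> [r Qm Qp]; set t := Num.max r 1.
have t0 : 0 < t by rewrite lt_max ltr01 orbT.
have rt : r <= t by rewrite le_max lexx.
exists (t ^+ 2).
  by apply: qmodule_subr_sqr => //; apply: qmodule_addC rt _.
by apply: qmoduleD (qmodule_sq _) => //; apply/qmodule_const/sqr_ge0.
Qed.

Lemma qbounded_scal r a : qbounded Q a -> qbounded Q (r%:A * a).
Proof.
wlog r0 : r a / 0 <= r => [W|].
  case: (leP 0 r) => [r0|r0 Ba]; first exact: W.
  by rewrite -mulrNN -scaleNr; apply: W (qboundedN Ba); rewrite oppr_ge0 ltW.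
move=> [t Qm Qp]; exists (r * t).
  by rewrite (_ : _ - _ = r%:A * (t%:A - a));
    [exact: qmodule_scal | rewrite !alg_morphE; ring].
by rewrite (_ : _ + _ = r%:A * (t%:A + a));
  [exact: qmodule_scal | rewrite !alg_morphE; ring].
Qed.

(** Reduces the stability under products of bounded, and later of infinitesimal, elements to sums,
    scalings and squares. *)
Lemma quarter_polarization a b :
  a * b = 4^-1%:A * ((a + b) ^+ 2 + - (a - b) ^+ 2).
Proof.
rewrite (_ : (a + b) ^+ 2 + _ = 4%:R * (a * b)); last by ring.
by rewrite -(scaler_nat 4 1) !mulr_algl scalerA mulVf ?scale1r ?pnatr_eq0.
Qed.

Lemma qboundedM a b : qbounded Q a -> qbounded Q b -> qbounded Q (a * b).
Proof.
move=> Ba Bb; rewrite quarter_polarization; apply: qbounded_scal.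
apply: qboundedD; first exact/qbounded_sq/qboundedD.
by apply/qboundedN/qbounded_sq/qboundedD/qboundedN.
Qed.

(* [f + r - 1/k] is obtained from [f + r] for a [k] independent of [r >= 0],
   so after finitely many steps the constant becomes negative. *)
Lemma qmodule_sumsqM_gt1 s f : qarchimedean Q -> sumsq s -> Q (s * f - 1) ->
  exists2 e, 0 < e & Q (f - e%:A).
Proof.
move=> Qarch ss Qsf; have [r1 Q1] := Qarch (s ^+ 2 * f).
have [r2 Q2] := Qarch s; have [r3 Q3] := Qarch (- f).
set k := Num.max 1 (Num.max r1 r2).
have k1 : 1 <= k by rewrite le_max lexx.
have k0 : 0 < k by apply: lt_le_trans k1.
have kr1 : r1 <= k by rewrite !le_max lexx !orbT.
have kr2 : r2 <= 2 * k.
  by apply: (@le_trans _ _ k); [rewrite !le_max lexx !orbT | lra].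
have {Q1} Q1 := qmodule_addC kr1 Q1; have {Q2} Q2 := qmodule_addC kr2 Q2.
have step r : 0 <= r -> Q (f + r%:A) -> Q (f + (r - k^-1)%:A).
  move=> r0 Qr; apply: (@qmodule_unscal (k ^+ 2)); first by rewrite exprn_gt0.
  have -> : (k ^+ 2)%:A * (f + (r - k^-1)%:A) =
            k%:A ^+ 2 * (f + r%:A) - k%:A.
    rewrite scalerBl addrA mulrBr; congr (_ - _).
      by rewrite !alg_morphE.
    by rewrite mulr_algl scalerA expr2 mulfK // gt_eqF.
  (* All summands lie in [Q]: [k] was chosen so that [2k - s] and [k - s^2 f] are members, and
     multiplying [2k - s] by the sum of squares [s] keeps it in [Q]. *)
  rewrite (_ : _ - _ = (k%:A - s) ^+ 2 * (f + r%:A) +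
     ((2 * k)%:A * (s * f - 1) +
     (r%:A * (s * ((2 * k)%:A - s)) + (k%:A - s ^+ 2 * f)))); last first.
    by rewrite !alg_morphE; ring.
  apply: qmoduleD => //; first exact: qmodule_sqM.
  apply: qmoduleD => //; first by apply: qmodule_scal; rewrite // mulr_ge0 ?ltW.
  apply: qmoduleD => //; apply: qmodule_scal => //; exact: qmodule_sumsqM.
have iter (n : nat) r : 0 <= r -> r < n%:R / k -> Q (f + r%:A) ->
    exists2 e, 0 < e & Q (f - e%:A).
  elim: n r => [|n IHn] r r0; first by rewrite mul0r ltNge r0.
  rewrite -natr1 mulrDl mul1r => rlt /(step _ r0) Qr.
  have [r'0|r'0] := leP 0 (r - k^-1); first by apply: IHn Qr => //; lra.
  by exists (- (r - k^-1)); [rewrite oppr_gt0 | rewrite scaleNr opprK].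
have [r r0 Qr] : exists2 r, 0 <= r & Q (f + r%:A).
  exists (Num.max 0 r3); first by rewrite le_max lexx.
  rewrite addrC; apply: (@qmodule_addC r3); first by rewrite le_max lexx orbT.
  by rewrite -[f]opprK.
(* Each step lowers the constant by [1/k], so more than [r k] steps are enough. *)
apply: (iter (Num.bound (r * k)) r) => //.
by rewrite ltr_pdivlMr // archi_boundP // mulr_ge0 // ltW.
Qed.

End Closure.

Lemma maximal_qmodule Q : qmodule Q -> ~ Q (-1) ->
  exists N, [/\ qmodule N, ~ N (-1), (forall a, Q a -> N a)
              & forall f, N f \/ adjoin N f (-1)].
Proof.
move=> Qmod Qproper.
(* Sets are joined with [Q] so that the empty chain, whose union is empty, still has an admissible
   upper bound. *)
pose join (B : set A) a := B a \/ Q a.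
pose P (B : set A) := qmodule (join B) /\ ~ join B (-1).
have [F F_P F_tot|B [[Bmod Bproper] Bmax]] := @Zorn_bigcup A P.
  have lift C a : F C -> join C a -> join (\bigcup_(X in F) X)%classic a.
    by move=> FC [Ca|Qa]; [left; exists C | right].
  (* Two elements of the union of a chain already lie together in one member, which gives closure
     under addition. *)
  have common a b : join (\bigcup_(X in F) X)%classic a ->
      join (\bigcup_(X in F) X)%classic b ->
      (Q a /\ Q b) \/ exists2 C, F C & join C a /\ join C b.
    case=> [[C FC Ca]|Qa] [[D FD Db]|Qb].
    - right; have [CD|DC] := F_tot _ _ FC FD.
        by exists D => //; split; left => //; apply: CD.
      by exists C => //; split; left => //; apply: DC.
    - by right; exists C => //; split; [left | right].
    - by right; exists D => //; split; [right | left].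
    - by left.
  split; last first.
    by case=> [[C FC C1]|//]; have [_ []] := F_P _ FC; left.
  split.
  - by right; apply: qmodule1 Qmod.
  - move=> a b /common ab /ab [[Qa Qb]|[C FC [Ca Cb]]].
      by right; apply: qmoduleD.
    by apply: (lift C) => //; have [Cmod _] := F_P _ FC; apply: qmoduleD.
  - move=> a b Fb; have [[_ Qb]|[C FC [_ Cb]]] := common _ _ Fb Fb.
      by right; apply: qmodule_sqM.
    by apply: (lift C) => //; have [Cmod _] := F_P _ FC; apply: qmodule_sqM.
exists (join B); split=> // [a Qa|f]; first by right.
have [Bf|Bf] := pselect (join B f); first by left.
right; apply: contrapT => Nproper.
have joinE : join (adjoin (join B) f) = adjoin (join B) f.
  apply/funext => a; apply/propext; split=> [[//|Qa]|]; last by left.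
  by apply: sub_adjoin; right.
(* The adjunction contains [B] and also [f], which [B] lacks; if it were proper, it would contradict
   the maximality of [B]. *)
apply: (Bmax (adjoin (join B) f)).
  split=> [a Ba|/(_ f)]; first by apply: sub_adjoin => //; left.
  by case/(_ (mem_adjoin Bmod f))/or_introl/Bf.
by rewrite /P joinE; split=> //; apply: adjoin_qmodule.
Qed.

(** * The real point of a maximal proper quadratic module *)

Section Maximal.
Variable N : A -> Prop.
Hypotheses (Nmod : qmodule N) (Nproper : ~ N (-1)).
Hypothesis Nmax : forall f, N f \/ adjoin N f (-1).

(** The support of [N], where both [b] and [- b] are members, absorbs products because
    [4ab = (a + 1)^2 b + (a - 1)^2 (- b)]. *)
Lemma qmodule_supportM a b : N b -> N (- b) -> N (a * b).
Proof.
move=> Nb Nb'; apply: (@qmodule_unscal _ Nmod 4); first exact: ltr0n.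
rewrite alg_morphE (_ : 4%:R * _ = (a + 1) ^+ 2 * b + (a - 1) ^+ 2 * (- b)).
  by apply: (qmoduleD Nmod); apply: (qmodule_sqM Nmod).
ring.
Qed.

(** Otherwise [-1 = q + s a = p - t a]. Eliminating [a] gives [- s = t + t q + s p], so [s] is in
    the support of [N]; then [s a], and with it [-1 = q + s a], is in [N]. *)
Lemma maximal_qmodule_total a : N a \/ N (- a).
Proof.
have [Na|[q [s [Nq ss E1]]]] := Nmax a; first by left.
have [Na|[p [t [Np st E2]]]] := Nmax (- a); first by right.
exfalso; apply: Nproper; rewrite E1; apply: (qmoduleD Nmod) => //.
rewrite mulrC; apply: qmodule_supportM; first exact: qmodule_sumsq.
have sa : s * a = - (1 + q) by rewrite opprD E1; ring.
have ta : t * a = 1 + p by rewrite -[1]opprK E2; ring.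
rewrite (_ : - s = t + t * q + s * p).
  apply: (qmoduleD Nmod); last exact: qmodule_sumsqM.
  by apply: (qmoduleD Nmod); [exact: qmodule_sumsq | exact: qmodule_sumsqM].
have : s * (t * a) = t * (s * a) by ring.
rewrite sa ta => E; transitivity (s * p - s * (1 + p)); first by ring.
by rewrite E; ring.
Qed.

(* The real point attached to a maximal [N] sends [a] to the unique real [r]
   such that [a - r] is infinitesimal. *)
Definition infinitesimal b :=
  forall e, 0 < e -> N (e%:A + b) /\ N (e%:A - b).

Lemma infinitesimalN b : infinitesimal b -> infinitesimal (- b).
Proof. by move=> Ib e /Ib []; rewrite opprK. Qed.

Lemma infinitesimalD b c :
  infinitesimal b -> infinitesimal c -> infinitesimal (b + c).
Proof.
move=> Ib Ic e e0; have e20 : 0 < e / 2 by rewrite divr_gt0.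
have [b1 b2] := Ib _ e20; have [c1 c2] := Ic _ e20.
rewrite (splitr e) scalerDl opprD; split; rewrite addrACA;
  exact: (qmoduleD Nmod).
Qed.

Lemma infinitesimal_scal r b : infinitesimal b -> infinitesimal (r%:A * b).
Proof.
wlog r0 : r b / 0 <= r => [W|].
  case: (leP 0 r) => [r0|r0 Ib]; first exact: W.
  rewrite -mulrNN -scaleNr; apply: W (infinitesimalN Ib).
  by rewrite oppr_ge0 ltW.
move: r0; rewrite le_eqVlt => /predU1P[<- _ e e0|r0 Ib e e0].
  by rewrite scale0r mul0r addr0 subr0; split; apply/(qmodule_const Nmod)/ltW.
have [b1 b2] := Ib (e / r) (divr_gt0 e0 r0).
have e_eq : e%:A = r%:A * (e / r)%:A :> A.
  by rewrite mulr_algl scalerA mulrCA divff ?mulr1 // gt_eqF.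
by rewrite e_eq -mulrN -!mulrDr; split; apply: qmodule_scal => //; apply: ltW.
Qed.

Lemma infinitesimal_sq b : infinitesimal b -> infinitesimal (b ^+ 2).
Proof.
move=> Ib e e0; have s0 : 0 < Num.sqrt e by rewrite sqrtr_gt0.
have [b1 b2] := Ib _ s0; split.
  by apply: (qmoduleD Nmod); [exact/(qmodule_const Nmod)/ltW | exact: qmodule_sq].
by rewrite -(sqr_sqrtr (ltW e0)); apply: qmodule_subr_sqr.
Qed.

Lemma infinitesimalM b c :
  infinitesimal b -> infinitesimal c -> infinitesimal (b * c).
Proof.
move=> Ib Ic; rewrite quarter_polarization; apply: infinitesimal_scal.
apply: infinitesimalD; first exact/infinitesimal_sq/infinitesimalD.
by apply/infinitesimalN/infinitesimal_sq/infinitesimalD/infinitesimalN.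
Qed.

Lemma qmodule_const_ge0 r : N r%:A -> 0 <= r.
Proof.
move=> Nr; rewrite leNgt; apply/negP => r0; apply: Nproper.
apply: (@qmodule_unscal _ Nmod (- r)); first by rewrite oppr_gt0.
by rewrite mulrN1 scaleNr opprK.
Qed.

Lemma infinitesimal_const r : infinitesimal r%:A -> r = 0.
Proof.
move=> Ir; apply/eqP; rewrite eq_le; apply/andP; split; apply/ler_addgt0Pr.
  move=> e /Ir [_]; rewrite -scalerBl add0r => /qmodule_const_ge0.
  by rewrite subr_ge0.
by move=> e /Ir []; rewrite -scalerDl addrC => /qmodule_const_ge0.
Qed.

(** The real number is the supremum of the cut of all [r] with [a - r] in [N]; the Archimedean
    property makes the cut nonempty and bounded. *)
Lemma infinitesimal_ex a : qarchimedean N -> exists r, infinitesimal (a - r%:A).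
Proof.
move=> Narch; pose S := [set r | N (a - r%:A)]%classic.
have [t Nt] := Narch a; have [t' Nt'] := Narch (- a).
have S_ub : ubound S t.
  move=> r Sr; rewrite -subr_ge0; apply: qmodule_const_ge0.
  by rewrite scalerBl -(subrK a t%:A) -addrA; apply: (qmoduleD Nmod).
have S_sup : has_sup S.
  split; last by exists t.
  by exists (- t'); rewrite /S /= scaleNr opprK addrC -[a]opprK.
exists (sup S) => e e0; split; last first.
  (* A number above the supremum is outside the cut, so totality puts the opposite element in
     [N]. *)
  have [Ne|] := maximal_qmodule_total (a - (sup S + e)%:A).
    have : sup S + e <= sup S by apply: ub_le_sup => //; exists t.
    by rewrite gerDl leNgt e0.
  suff <- : - (a - (sup S + e)%:A) = e%:A - (a - (sup S)%:A) by [].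
  by rewrite scalerDl; ring.
have [r Sr /ltW ltr] := sup_adherent e0 S_sup.
have -> : e%:A + (a - (sup S)%:A) = (e + r - sup S)%:A + (a - r%:A).
  by rewrite scalerBl scalerDl; ring.
by apply: (qmoduleD Nmod) => //; apply: qmodule_const => //; lra.
Qed.

(** The only infinitesimal constant is 0, so the real part is unique, and additivity and
    multiplicativity follow by exhibiting an infinitesimal difference. *)
Lemma maximal_qmodule_point : qarchimedean N ->
  exists2 phi, real_point phi & forall a, N a -> 0 <= phi a.
Proof.
move=> Narch; have [phi phiP] := choice (fun a => infinitesimal_ex a Narch).
have phi_uniq a r : infinitesimal (a - r%:A) -> phi a = r.
  move=> Ir; apply/eqP; rewrite -subr_eq0; apply/eqP/infinitesimal_const.
  rewrite (_ : _%:A = (a - r%:A) + - (a - (phi a)%:A)).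
    by apply: infinitesimalD => //; apply: infinitesimalN.
  by rewrite scalerBl; ring.
exists phi.
  split=> [a b|a b|r]; apply: phi_uniq.
  - rewrite scalerDl opprD addrACA; exact: infinitesimalD.
  - rewrite alg_morphE (_ : _ - _ = (a - (phi a)%:A) * (b - (phi b)%:A) +
      ((phi a)%:A * (b - (phi b)%:A) + (phi b)%:A * (a - (phi a)%:A))).
      apply: infinitesimalD; first exact: infinitesimalM.
      by apply: infinitesimalD; apply: infinitesimal_scal.
    ring.
  - by rewrite subrr => e e0; rewrite addr0 subr0; split;
      apply/(qmodule_const Nmod)/ltW.
move=> a Na; apply/ler_addgt0Pr => e e0; rewrite addrC.
have [_ Ne] := phiP a e e0; apply: qmodule_const_ge0.
rewrite scalerDl (_ : _ + _ = e%:A - (a - (phi a)%:A) + a); last by ring.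
exact: (qmoduleD Nmod).
Qed.

End Maximal.

Lemma sub_qarchimedean Q N :
  (forall a, Q a -> N a) -> qarchimedean Q -> qarchimedean N.
Proof. by move=> QN Qarch a; have [r Qr] := Qarch a; exists r; apply: QN. Qed.

Theorem qmodule_positivstellensatz Q f : qmodule Q -> qarchimedean Q ->
  (forall phi, real_point phi -> (forall a, Q a -> 0 <= phi a) -> 0 < phi f) ->
  exists2 e, 0 < e & Q (f - e%:A).
Proof.
move=> Qmod Qarch fpos.
have [[q [s [Qq ss E]]]|proper] := pselect (adjoin Q (- f) (-1)).
  (* Here [-1 = q - s f], that is, [s f - 1 = q] is in [Q]. *)
  apply: (qmodule_sumsqM_gt1 Qmod Qarch ss).
  by rewrite E (_ : s * f + _ = q) //; ring.
have [N [Nmod Nproper QN Nmax]] :=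
  maximal_qmodule (adjoin_qmodule Qmod (- f)) proper.
have QN' a : Q a -> N a by move/(sub_adjoin (- f))/QN.
have [phi phiP phi_ge0] := maximal_qmodule_point Nmod Nproper Nmax
  (sub_qarchimedean QN' Qarch).
have := fpos phi phiP (fun a Qa => phi_ge0 a (QN' a Qa)).
have := phi_ge0 _ (QN _ (mem_adjoin Qmod (- f))).
rewrite -[- f]mulN1r -scaleN1r real_pointM // real_pointA // mulN1r oppr_ge0.
by move=> /le_lt_trans H /H; rewrite ltxx.
Qed.

End QuadraticModules.

(** * Putinar's Positivstellensatz *)

Lemma real_point_meval (R : realType) (k : nat) (phi : {mpoly R[k]} -> R) :
  real_point phi -> exists x : 'I_k -> R, forall p, phi p = p.@[x].
Proof.
case=> phiD phiM phiA; exists (fun i => phi 'X_i).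
have phi0 : phi 0 = 0 by rewrite -(scale0r 1) phiA.
have phi1 : phi 1 = 1 by rewrite -(scale1r 1) phiA.
elim/mpolyind=> [|c m p _ _ IHp]; first by rewrite phi0 meval0.
rewrite phiD mevalD -IHp -mulr_algl phiM phiA mevalM mevalZ meval1 mulr1.
rewrite mevalX mpolyXE_id (big_morph phi phiM phi1).
congr (_ * _ + _); apply: eq_bigr => i _.
by elim: (m i) => [|e IHe]; rewrite ?expr0 // !exprS phiM IHe.
Qed.

Section Putinar.
Variables (R : realType) (k : nat) (I J : finType).
Variables (g : I -> {mpoly R[k]}) (h : J -> {mpoly R[k]}).
Local Notation Q := (quad_module g h).

Lemma quad_moduleP : qmodule Q.
Proof.
split.
- exists (1 ^+ 2), (fun=> 0), (fun=> 0); split=> [|i|].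
  + exact: sumsq_sq.
  + exact: sumsq0.
  + by rewrite expr1n !big1 ?addr0 // => i _; rewrite mul0r.
- move=> _ _ [s0 [s [f [ss0 ss ->]]]] [t0 [t [e [st0 st ->]]]].
  exists (s0 + t0), (fun i => s i + t i), (fun j => f j + e j); split.
  + exact: sumsqD ss0 st0.
  + by move=> i; exact: sumsqD (ss i) (st i).
  + under [in RHS]eq_bigr do rewrite mulrDl.
    under [X in _ = _ + X]eq_bigr do rewrite mulrDl.
    by rewrite !big_split /=; ring.
- move=> a _ [s0 [s [f [ss0 ss ->]]]].
  exists (a ^+ 2 * s0), (fun i => a ^+ 2 * s i), (fun j => a ^+ 2 * f j); split.
  + exact: sumsq_sqM ss0.
  + by move=> i; exact: sumsq_sqM (ss i).
  + rewrite !mulrDr !mulr_sumr; congr (_ + _ + _);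
      by apply: eq_bigr => i _; rewrite mulrA.
Qed.

Lemma quad_module_ineq i : Q (g i).
Proof.
exists 0, (fun l => (l == i)%:R ^+ 2), (fun=> 0); split=> [|l|].
- exact: sumsq0.
- exact: sumsq_sq.
- rewrite [X in _ + X]big1 => [|j _]; last by rewrite mul0r.
  rewrite add0r addr0 (bigD1 i) //= eqxx expr1n mul1r big1 ?addr0 //.
  by move=> l /negbTE->; rewrite expr0n mul0r.
Qed.

Lemma quad_module_eq (f : {mpoly R[k]}) j : Q (f * h j).
Proof.
exists 0, (fun=> 0), (fun l => f *+ (l == j)); split=> [|l|].
- exact: sumsq0.
- exact: sumsq0.
- rewrite [X in _ + X + _]big1 => [|i _]; last by rewrite mul0r.
  rewrite !add0r (bigD1 j) //= eqxx big1 ?addr0 // => l /negbTE->.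
  by rewrite mul0r.
Qed.

Lemma quad_module_eval x p : (forall i, 0 <= (g i).@[x]) ->
  (forall j, (h j).@[x] = 0) -> Q p -> 0 <= p.@[x].
Proof.
move=> gx hx [s0 [s [f [ss0 ss ->]]]].
have sos_ge0 q : sos q -> 0 <= q.@[x].
  case=> l ->; rewrite (raddf_sum (meval x)) sumr_ge0 // => r _.
  by rewrite /= expr2 mevalM sqr_ge0.
rewrite !mevalD !(raddf_sum (meval x)) [X in _ + X]big1 => [|j _].
  rewrite addr0 addr_ge0 ?sos_ge0 ?sumr_ge0 // => i _.
  by rewrite /= mevalM mulr_ge0 // sos_ge0.
by rewrite /= mevalM hx mulr0.
Qed.

(** Adding the squares of the other variables to the ball certificate bounds [X_i^2], and [r + 1 - 2
    X_i = (r - X_i^2) + (1 - X_i)^2] then bounds [X_i]. Bounded elements form a subalgebra, hence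
    are all polynomials. *)
Lemma archimedean_moduleP : archimedean_module g h -> qarchimedean Q.
Proof.
case=> r _ Qr; have Qmod := quad_moduleP.
have Xbnd i : qbounded Q 'X_i.
  have Qi : Q (r%:MP - 'X_i ^+ 2).
    rewrite (bigD1 i) //= in Qr.
    rewrite -[_ - _](addrK (\sum_(j < k | j != i) 'X_j ^+ 2)) addrAC.
    apply: qmoduleD => //; last first.
      apply: (big_ind Q) => [||j _]; [exact: qmodule0 | exact: qmoduleD |].
      exact: qmodule_sq.
    by rewrite -addrA -opprD.
  exists ((r + 1) / 2); apply: (qmodule_unscal Qmod (ltr0n _ 2));
    rewrite ?mulrBr ?mulrDr -alg_morphE mulrCA divff ?mulr1 ?pnatr_eq0 //;
    rewrite scalerDl scale1r alg_mpolyC alg_morphE.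
  - rewrite (_ : _ - _ = r%:MP - 'X_i ^+ 2 + (1 - 'X_i) ^+ 2); last by ring.
    by apply: qmoduleD => //; apply: qmodule_sq.
  - rewrite (_ : _ + _ = r%:MP - 'X_i ^+ 2 + (1 + 'X_i) ^+ 2); last by ring.
    by apply: qmoduleD => //; apply: qmodule_sq.
suff bnd p : qbounded Q p by move=> p; have [t Qt _] := bnd p; exists t.
have const c : qbounded Q c%:A by apply: qbounded_const.
elim/mpolyind: p => [|c m p _ _ IHp]; first by rewrite -(scale0r 1).
apply: qboundedD => //; rewrite -mulr_algl; apply: qboundedM => //.
rewrite mpolyXE_id; apply: (big_ind (qbounded Q)) => [||i _].
- by rewrite -(scale1r 1).
- by move=> *; apply: qboundedM.
- elim: (m i) => [|e IHe]; first by rewrite expr0 -(scale1r 1).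
  by rewrite exprS; apply: qboundedM.
Qed.

Theorem putinar_positivstellensatz (f : {mpoly R[k]}) :
  archimedean_module g h ->
  (forall x, (forall i, 0 <= (g i).@[x]) -> (forall j, (h j).@[x] = 0) ->
     0 < f.@[x]) ->
  exists2 e, 0 < e & Q (f - e%:MP).
Proof.
move=> /archimedean_moduleP Qarch fpos.
have [phi phiP phi_ge0|e e0] :=
  qmodule_positivstellensatz (f := f) quad_moduleP Qarch; last first.
  by rewrite alg_mpolyC; exists e.
have [x phiE] := real_point_meval phiP.
rewrite phiE; apply: fpos => [i|j].
  by rewrite -phiE; apply/phi_ge0/quad_module_ineq.
(* Both [h j] and its opposite are in the module, so the value at the point is zero. *)
apply/eqP; rewrite eq_le -oppr_ge0 -mevalN -!phiE.
rewrite -[h j]mul1r !phi_ge0 // -?mulNr; exact: quad_module_eq.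
Qed.

Lemma archimedean_lower_bound (f : {mpoly R[k]}) :
  archimedean_module g h ->
  (forall x, (forall i, 0 <= (g i).@[x]) -> (forall j, (h j).@[x] = 0) ->
     0 < f.@[x]) ->
  exists2 e, 0 < e & forall x, (forall i, 0 <= (g i).@[x]) ->
    (forall j, (h j).@[x] = 0) -> e <= f.@[x].
Proof.
move=> arch /(putinar_positivstellensatz arch)[e e0 Qe]; exists e => // x gx hx.
by have := quad_module_eval gx hx Qe; rewrite mevalB mevalC subr_ge0.
Qed.

Lemma archimedean_bounded (f : {mpoly R[k]}) :
  archimedean_module g h ->
  exists c, forall x, (forall i, 0 <= (g i).@[x]) ->
    (forall j, (h j).@[x] = 0) -> `|f.@[x]| <= c.
Proof.
move=> /archimedean_moduleP Qarch; have [c Qc] := Qarch f.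
have [c' Qc'] := Qarch (- f); exists (`|c| + `|c'|) => x gx hx.
have := quad_module_eval gx hx Qc; have := quad_module_eval gx hx Qc'.
rewrite !alg_mpolyC mevalB mevalN [(_ - f).@[x]]mevalB !mevalC => h' h0.
rewrite ler_norml; apply/andP.
by have := ler_norm c; have := ler_norm c'; have := normr_ge0 c;
  have := normr_ge0 c'; split; lra.
Qed.

(** One certificate serves every [d] above the largest size of its terms, since the degree bounds
    only relax. *)
Lemma quad_module_leW p : Q p ->
  exists d0 : nat, forall d, (d0 <= d)%N -> quad_module_le g h d p.
Proof.
move=> [s0 [s [f [ss0 ss Ep]]]].
exists (maxn (msize s0) (maxn (\max_i msize (s i * g i))
                              (\max_j msize (f j * h j)))) => d.
rewrite !geq_max => /and3P[d_s0 /bigmax_leqP d_s /bigmax_leqP d_f].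
exists s0, s, f; split=> //; split=> [|i|j]; apply: leqW => //.
  exact: d_s.
exact: d_f.
Qed.

Lemma quad_module_leS d p : quad_module_le g h d p -> Q p.
Proof. by move=> [s0 [s [f [? ? ? _]]]]; exists s0, s, f. Qed.

End Putinar.

(** * Polynomial approximation of the absolute value *)

(** A discrete form of the fact that [2 / (z + 2)] solves [d' = - d^2 / 2]. *)
Lemma quadratic_decay_step (R : realFieldType) (d z : R) :
  0 <= z -> 0 <= d -> d * (z + 2) <= 2 ->
  d * (1 - 2^-1 * d) * (z + 1 + 2) <= 2.
Proof.
move=> z0 d0 dz; have d1 : d <= 1 by nra.
have : 0 <= (2 - d * (z + 2)) * (1 - 2^-1 * d) by rewrite mulr_ge0; lra.
by have := sqr_ge0 d; nra.
Qed.

Lemma abs_iter_bound (R : realType) (y : R) (e : nat -> R) :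
  `|y| <= 1 -> e 0 = 0 ->
  (forall k, e k.+1 = e k + 2^-1 * (y ^+ 2 - e k ^+ 2)) ->
  forall k, 0 <= e k <= `|y| /\ `|y| - e k <= 2 / (k%:R + 2).
Proof.
move=> y1 e0 eS; rewrite -real_normK ?num_real // in eS.
have := normr_ge0 y; move: `|y| y1 eS => t t1 eS t0.
elim=> [|k [/andP[ek0 ekt] IHk]].
  by rewrite e0 subr0 add0r divff ?pnatr_eq0 // lexx t0.
(* This factorization keeps the iterates below [t]; since [t + e k >= t - e k], it also gives the
   quadratic decay of the error. *)
have es : t - e k.+1 = (t - e k) * (1 - 2^-1 * (t + e k)).
  by rewrite eS; field.
have f0 : 0 <= 1 - 2^-1 * (t + e k) by lra.
have step : t - e k.+1 <= (t - e k) * (1 - 2^-1 * (t - e k)).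
  by rewrite es ler_wpM2l; lra.
have ek1_le : e k.+1 <= t by rewrite -subr_ge0 es mulr_ge0; lra.
split.
  rewrite ek1_le andbT eS addr_ge0 // mulr_ge0 ?invr_ge0 // subr_ge0.
  by rewrite lerXn2r // nnegrE.
have k0 : 0 <= k%:R :> R by [].
apply: (le_trans step); have : 0 <= t - e k by lra.
move: (t - e k) IHk => d dk d0.
rewrite -(natr1 k).
rewrite ler_pdivlMr; last by lra.
rewrite ler_pdivlMr in dk; last by lra.
exact: quadratic_decay_step.
Qed.

Section AbsoluteValue.
Variables (R : realType) (k : nat).

(* For [|y| <= 1] the iterates increase to [|y|], since the error is multiplied
   by [1 - (|y| + p) / 2] at each step. *)
Fixpoint mpoly_abs (y : {mpoly R[k]}) (l : nat) : {mpoly R[k]} :=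
  if l is l'.+1 then
    mpoly_abs y l' + 2^-1%:MP * (y ^+ 2 - mpoly_abs y l' ^+ 2)
  else 0.

(** Dividing by [b >= c] brings the values into [-1, 1]. The rescaled iterate underestimates the
    absolute value by less than [eta], so adding [eta] yields a strict majorant. *)
Lemma mpoly_abs_majorant (y : {mpoly R[k]}) (c eta : R) : 0 < eta ->
  exists M : {mpoly R[k]}, forall x, `|y.@[x]| <= c ->
    `|y.@[x]| < M.@[x] <= `|y.@[x]| + eta.
Proof.
move=> eta0; set b := Num.max 1 c.
have b0 : 0 < b by rewrite lt_max ltr01.
pose l := Num.bound (2 * b / eta).
have hl : 2 * b / (l%:R + 2) < eta.
  have : 2 * b / eta < l%:R.
    by rewrite archi_boundP // divr_ge0 ?mulr_ge0 // ltW.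
  have l0 : 0 <= l%:R :> R by [].
  by rewrite !ltr_pdivrMr //; [nra | lra].
exists (b%:MP * mpoly_abs (b^-1%:MP * y) l + eta%:MP) => x yc.
have yb : `|b^-1 * y.@[x]| = b^-1 * `|y.@[x]|.
  by rewrite normrM gtr0_norm // invr_gt0.
have yb1 : `|b^-1 * y.@[x]| <= 1.
  rewrite yb ler_pdivrMl // mulr1 (le_trans yc) //.
  by rewrite le_max lexx orbT.
have [] := abs_iter_bound (e := fun l => (mpoly_abs (b^-1%:MP * y) l).@[x])
  yb1 _ _ l.
- by rewrite /= meval0.
- by move=> l' /=; rewrite mevalD !expr2 !mevalM mevalB !mevalM !mevalC.
set p := (mpoly_abs _ _).@[x]; rewrite yb => /andP[p0 py] yp.
rewrite mevalD mevalM !mevalC -/p.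
have h1 : b * p <= `|y.@[x]| by rewrite -ler_pdivlMl.
have h2 : `|y.@[x]| - b * p <= 2 * b / (l%:R + 2).
  rewrite (_ : _ - _ = b * (b^-1 * `|y.@[x]| - p)).
    by rewrite (_ : 2 * b / _ = b * (2 / (l%:R + 2))) ?ler_pM2l //; ring.
  by rewrite mulrBr mulrA divff ?mul1r // gt_eqF.
lra.
Qed.

End AbsoluteValue.

(** * The consistency set *)

Lemma invmx_diag_mx (F : fieldType) (n : nat) (v : 'rV[F]_n) :
  (forall i, v 0 i != 0) -> invmx (diag_mx v) = diag_mx (\row_i (v 0 i)^-1).
Proof.
move=> v_neq0; set w := diag_mx (\row_i _).
have vw : diag_mx v *m w = 1%:M.
  by rewrite mulmx_diag; apply/matrixP => i j; rewrite !mxE mulfV.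
have [v_unit _] := mulmx1_unit vw.
by rewrite -[LHS]mulmx1 -vw mulKmx.
Qed.

(** Multiplying row [i] by [v_i] makes the condition affine in the plant, with coefficients linear
    in [v] and [S = K diag(v)]. *)
Lemma ext_superstableE (R : realType) (n m : nat) (v : 'rV[R]_n)
    (K : 'M[R]_(m, n)) (A : 'M[R]_n) (B : 'M[R]_(n, m)) :
  (forall i, 0 < v 0 i) ->
  ext_superstable v K A B <->
  forall i, \sum_j `|A i j * v 0 j + \sum_l B i l * (K l j * v 0 j)| < v 0 i.
Proof.
move=> v0; have v_neq0 i : v 0 i != 0 by rewrite gt_eqF.
rewrite /ext_superstable /mx_infnorm.
rewrite invmx_diag_mx //.
have entry i j :
    (diag_mx (\row_i (v 0 i)^-1) *m (A + B *m K) *m diag_mx v) i j =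
    (v 0 i)^-1 * (A i j * v 0 j + \sum_l B i l * (K l j * v 0 j)).
  rewrite mul_mx_diag mul_diag_mx !mxE -mulrA mulrDl; congr (_ * (_ + _)).
  by rewrite mulr_suml; apply: eq_bigr => l _; rewrite mulrA.
have row_sum i :
    \sum_j `|(diag_mx (\row_i (v 0 i)^-1) *m (A + B *m K) *m diag_mx v) i j| =
    (v 0 i)^-1 *
      \sum_j `|A i j * v 0 j + \sum_l B i l * (K l j * v 0 j)|.
  rewrite mulr_sumr; apply: eq_bigr => j _.
  by rewrite entry normrM gtr0_norm // invr_gt0.
split.
  move=> /(bigmax_ltP _ _ _ _)[_ lt1] i; have := lt1 i isT.
  by rewrite row_sum ltr_pdivrMl // mulr1.
move=> lt_v; apply/bigmax_ltP; split=> // i _.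
by rewrite row_sum ltr_pdivrMl // mulr1.
Qed.

(** Used with evaluation at a point, to turn the polynomial constraints into the numerical ones. *)
Lemma map_residual (S S' : comNzRingType) (f : {rmorphism S -> S'})
    (n m T : nat) (xh : 'M[S]_(n, T)) (u : 'M[S]_(m, T.-1)) A B Dx t :
  map_mx f (residual xh u A B Dx t) =
  residual (map_mx f xh) (map_mx f u) (map_mx f A) (map_mx f B) (map_mx f Dx) t.
Proof.
by rewrite /residual /residual0 !(map_mxD, map_mxN, map_mxM, map_col).
Qed.

Lemma uniform_threshold (I : finType) (P : I -> nat -> Prop) :
  (forall i, exists d0, forall d, (d0 <= d)%N -> P i d) ->
  exists d0, forall d, (d0 <= d)%N -> forall i, P i d.
Proof.
move=> /choice[b bP]; exists (\max_i b i) => d /bigmax_leqP bd i.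
exact/bP/bd.
Qed.

Section ConsistencyPoints.
Variables (R : realType) (n m T : nat).

Local Notation point := ('I_(dimABx n m T) -> R).

Definition point_AB (x : point) (i : 'I_(dimAB n m)) : R := x (lshift (n * T) i).

Definition point_A (x : point) : 'M[R]_n :=
  \matrix_(i, j) point_AB x (lshift (n * m) (mxvec_index i j)).

Definition point_B (x : point) : 'M[R]_(n, m) :=
  \matrix_(i, j) point_AB x (rshift (n * n) (mxvec_index i j)).

Definition point_Dx (x : point) : 'M[R]_(n, T) :=
  \matrix_(i, t) x (rshift (dimAB n m) (mxvec_index i t)).

Lemma point_surj A B Dx :
  exists x, [/\ point_A x = A, point_B x = B & point_Dx x = Dx].
Proof.
exists (fun i => row_mx (row_mx (mxvec A) (mxvec B)) (mxvec Dx) 0 i).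
by split; apply/matrixP => i j;
  rewrite mxE /point_AB !(row_mxEl, row_mxEr) mxvecE.
Qed.

Lemma embed_AB_meval (x : point) (p : {mpoly R[dimAB n m]}) :
  (embed_AB T p).@[x] = p.@[point_AB x].
Proof.
rewrite comp_mpoly_meval; apply: meval_eq => i.
by rewrite tnth_mktuple mevalXU.
Qed.

Lemma varA_meval (x : point) i j :
  (varA R n m i j).@[point_AB x] = point_A x i j.
Proof. by rewrite !mxE mevalXU. Qed.

Lemma varB_meval (x : point) i j :
  (varB R n m i j).@[point_AB x] = point_B x i j.
Proof. by rewrite !mxE mevalXU. Qed.

Variables (eps : R) (xh : 'M[R]_(n, T)) (u : 'M[R]_(m, T.-1)).
Hypothesis eps_ge0 : 0 <= eps.

Lemma cons_eq_meval (x : point) c :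
  (cons_eq xh u c).@[x] =
  residual xh u (point_A x) (point_B x) (point_Dx x) c.1 c.2 0.
Proof.
have -> : (cons_eq xh u c).@[x] = map_mx (meval x) (residual
    (map_mx (@mpolyC _ R) xh) (map_mx (@mpolyC _ R) u)
    (map_mx (@embed_AB R n m T) (varA R n m))
    (map_mx (@embed_AB R n m T) (varB R n m)) (varDx R n m T) c.1) c.2 0.
  by rewrite [RHS]mxE.
have mapC p q (N : 'M[R]_(p, q)) :
    map_mx (meval x) (map_mx (@mpolyC _ R) N) = N.
  by apply/matrixP => i j; rewrite 2!mxE mevalC.
have mapA : map_mx (meval x) (map_mx (@embed_AB R n m T) (varA R n m)) =
    point_A x.
  by apply/matrixP => i j; rewrite 2!mxE embed_AB_meval varA_meval.
have mapB : map_mx (meval x) (map_mx (@embed_AB R n m T) (varB R n m)) =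
    point_B x.
  by apply/matrixP => i j; rewrite 2!mxE embed_AB_meval varB_meval.
have mapDx : map_mx (meval x) (varDx R n m T) = point_Dx x.
  by apply/matrixP => i t; rewrite 3!mxE mevalXU.
by rewrite map_residual !mapC mapA mapB mapDx.
Qed.

Lemma consistent_extP (x : point) :
  consistent_ext eps xh u (point_A x) (point_B x) (point_Dx x) <->
  (forall c, 0 <= (cons_ineq m eps c).@[x]) /\
  (forall c, (cons_eq xh u c).@[x] = 0).
Proof.
split=> [[res0 Dx_eps]|[ineq0 eq0]]; split.
- case=> [[t i] b] /=.
  have /(bigmax_leP _ _ _ _)[_ /(_ i isT)] := Dx_eps t.
  rewrite big_ord1 !mxE ler_norml => /andP[h1 h2].
  by case: b; rewrite ?mevalB ?mevalD mevalC mevalXU; lra.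
- by move=> c; rewrite cons_eq_meval res0 mxE.
- move=> t; apply/matrixP => i j; rewrite ord1.
  by have := eq0 (t, i); rewrite cons_eq_meval /= => ->; rewrite mxE.
(* The maximum starts from 0, so [0 <= eps] is needed here. *)
- move=> t; apply/bigmax_leP; split=> // i _; rewrite big_ord1 !mxE.
  have := ineq0 (t, i, true); have := ineq0 (t, i, false).
  rewrite /= mevalB mevalD mevalC mxE mevalXU ler_norml => h1 h2.
  by apply/andP; split; lra.
Qed.

Definition closed_loop (v : 'rV[R]_n) (S : 'M[R]_(m, n)) i j
    : {mpoly R[dimAB n m]} :=
  varA R n m i j * (v 0 j)%:MP + \sum_l varB R n m i l * (S l j)%:MP.

Lemma closed_loop_meval v S i j (x : point) :
  (closed_loop v S i j).@[point_AB x] =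
  point_A x i j * v 0 j + \sum_l point_B x i l * S l j.
Proof.
rewrite mevalD mevalM mevalC varA_meval (raddf_sum (meval _)); congr (_ + _).
by apply: eq_bigr => l _; rewrite /= mevalM mevalC varB_meval.
Qed.

Lemma Sigma_cons_le_ge0 d (x : point) p :
  consistent_ext eps xh u (point_A x) (point_B x) (point_Dx x) ->
  Sigma_cons_le eps xh u d (embed_AB T p) -> 0 <= p.@[point_AB x].
Proof.
move=> /consistent_extP[ineq0 eq0] /quad_module_leS.
by move/(quad_module_eval ineq0 eq0); rewrite embed_AB_meval.
Qed.

(** Putinar's theorem gives a certificate for [p - e]; adding the constant [e] gives one for [p], of
    some finite degree. *)
Lemma Sigma_cons_positive p : archimedean_cons eps xh u ->
  (forall x : point,
     consistent_ext eps xh u (point_A x) (point_B x) (point_Dx x) ->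
     0 < p.@[point_AB x]) ->
  exists d0, forall d, (d0 <= d)%N -> Sigma_cons_le eps xh u d (embed_AB T p).
Proof.
move=> arch ppos; apply: quad_module_leW.
have [|e e0] := putinar_positivstellensatz (f := embed_AB T p) arch.
  move=> x ineq0 eq0; rewrite embed_AB_meval; apply: ppos.
  exact/consistent_extP.
rewrite -alg_mpolyC => Qp; rewrite -(subrK e%:A (embed_AB T p)).
have Qmod := quad_moduleP (cons_ineq m eps) (cons_eq xh u).
exact: (qmoduleD Qmod Qp (qmodule_const Qmod (ltW e0))).
Qed.

Lemma cons_bounded p : archimedean_cons eps xh u ->
  exists c, forall x : point,
    consistent_ext eps xh u (point_A x) (point_B x) (point_Dx x) ->
    `|p.@[point_AB x]| <= c.
Proof.
move=> /(archimedean_bounded (embed_AB T p))[c cP]; exists c => x.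
by move=> /consistent_extP[ineq0 eq0]; rewrite -embed_AB_meval; apply: cP.
Qed.

(* Splitting according to the signs of the entries reduces the margin to
   finitely many polynomials that are positive on the consistency set. *)
Lemma closed_loop_margin v S : archimedean_cons eps xh u ->
  (forall x : point,
     consistent_ext eps xh u (point_A x) (point_B x) (point_Dx x) ->
     forall i, \sum_j `|(closed_loop v S i j).@[point_AB x]| < v 0 i) ->
  exists2 e, 0 < e & forall x : point,
     consistent_ext eps xh u (point_A x) (point_B x) (point_Dx x) ->
     forall i, \sum_j `|(closed_loop v S i j).@[point_AB x]| <= v 0 i - e.
Proof.
move=> arch stable.
(* One polynomial per row and sign pattern; each signed sum is at most the sum of absolute
   values. *)
pose F (c : 'I_n * {ffun 'I_n -> bool}) : {mpoly R[dimAB n m]} :=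
  (v 0 c.1)%:MP - \sum_j ((-1) ^+ c.2 j)%:MP * closed_loop v S c.1 j.
have FE c x : (F c).@[point_AB x] =
    v 0 c.1 - \sum_j (-1) ^+ c.2 j * (closed_loop v S c.1 j).@[point_AB x].
  rewrite mevalB mevalC (raddf_sum (meval _)); congr (_ - _).
  by apply: eq_bigr => j _; rewrite /= mevalM mevalC.
have /choice[e eP] c : exists e, 0 < e /\ forall x : point,
    consistent_ext eps xh u (point_A x) (point_B x) (point_Dx x) ->
    e <= (F c).@[point_AB x].
  have [x ineq0 eq0|e e0 eF] := archimedean_lower_bound
      (f := embed_AB T (F c)) arch; last first.
    exists e; split=> // x /consistent_extP[ineq0 eq0].
    by rewrite -embed_AB_meval; apply: eF.
  have cx := (consistent_extP x).2 (conj ineq0 eq0).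
  rewrite embed_AB_meval FE subr_gt0; apply: le_lt_trans (stable x cx c.1).
  by apply: ler_sum => j _; apply: le_trans (ler_norm _) _; rewrite normrMsign.
exists (\big[Num.min/1]_c e c).
  by apply: lt_bigmin => // c _; have [] := eP c.
move=> x cx i.
(* For the actual signs at [x], the signed sum equals the sum of absolute values. *)
pose s := [ffun j => (closed_loop v S i j).@[point_AB x] < 0].
have [_ /(_ x cx)] := eP (i, s); rewrite FE /=.
under eq_bigr => j _ do rewrite ffunE -normrEsign.
have := bigmin_le 1 (i, s) e.
lra.
Qed.

End ConsistencyPoints.

(** * Soundness and asymptotic completeness of the program *)

Unset Implicit Arguments.

Theorem theorem3p1 (R : realType) (n m T : nat)
    (n_ge1 : (1 <= n)%N) (m_ge1 : (1 <= m)%N) (T_ge2 : (2 <= T)%N)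
    (eps : R) (eps_ge0 : 0 <= eps)
    (xh : 'M[R]_(n, T)) (u : 'M[R]_(m, T.-1))
    (archP : archimedean_cons eps xh u)
    (delta : R) (delta_gt0 : 0 < delta) :
  (forall (d : nat) (v : 'rV[R]_n) (S : 'M[R]_(m, n))
      (M : 'M[{mpoly R[dimAB n m]}]_n),
      program_feasible eps xh u delta d v S M ->
      forall (A : 'M[R]_n) (B : 'M[R]_(n, m)), consistent eps xh u A B ->
        ext_superstable v (S *m invmx (diag_mx v)) A B)
  /\
  ((exists (v : 'rV[R]_n) (K : 'M[R]_(m, n)),
      (forall i, 0 < v 0 i) /\
      forall (A : 'M[R]_n) (B : 'M[R]_(n, m)), consistent eps xh u A B ->
        ext_superstable v K A B) ->
   exists d0 : nat, forall d : nat, (d0 <= d)%N ->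
     exists (v : 'rV[R]_n) (S : 'M[R]_(m, n))
       (M : 'M[{mpoly R[dimAB n m]}]_n),
       program_feasible eps xh u delta d v S M).
Proof.
split=> [d v S M [v0 _ rowP addP subP] A B [Dx cABx]|].
  have [x [xA xB xDx]] := point_surj A B Dx.
  have cx : consistent_ext eps xh u (point_A x) (point_B x) (point_Dx x).
    by rewrite xA xB xDx.
  have v_neq0 i : v 0 i != 0 by rewrite gt_eqF.
  apply/ext_superstableE => // i.
  have := Sigma_cons_le_ge0 eps_ge0 cx (rowP i).
  rewrite 2!mevalB !mevalC (raddf_sum (meval _)) => row_ge0.
  (* The row sum of [M] is at most [v_i - delta], and [delta > 0] makes the bound strict. *)
  apply: (@le_lt_trans _ _ (\sum_j (M i j).@[point_AB x])); last by lra.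
  apply: ler_sum => j _.
  have := Sigma_cons_le_ge0 eps_ge0 cx (addP i j).
  have := Sigma_cons_le_ge0 eps_ge0 cx (subP i j).
  rewrite mevalB mevalD closed_loop_meval xA xB => sub_ge0 add_ge0.
  have diagK l : (S *m invmx (diag_mx v)) l j * v 0 j = S l j.
    by rewrite invmx_diag_mx // mul_mx_diag !mxE divfK.
  under eq_bigr => l _ do rewrite diagK.
  by rewrite ler_norml; apply/andP; split; lra.
move=> [v [K [v0 stable]]].
pose S : 'M[R]_(m, n) := \matrix_(l, j) (K l j * v 0 j).
have [|e e0 margin] := closed_loop_margin (v := v) (S := S) eps_ge0 archP.
  move=> x cx i; have := stable _ _ (ex_intro _ _ cx).
  move=> /(ext_superstableE _ _ _ v0)/(_ i); congr (_ < _).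
  apply: eq_bigr => j _; rewrite closed_loop_meval; congr `|_ + _|.
  by apply: eq_bigr => l _; rewrite [S l j]mxE.
have n0 : 0 < n%:R :> R by rewrite ltr0n.
(* The [n] approximation errors of a row then use up at most half of the margin [e]. *)
pose eta := e / (2 * n%:R); have eta0 : 0 < eta by rewrite divr_gt0 ?mulr_gt0.
have /choice[M MP] (c : 'I_n * 'I_n) : exists M : {mpoly R[dimAB n m]},
    forall x, consistent_ext eps xh u (point_A x) (point_B x) (point_Dx x) ->
    let y := (closed_loop v S c.1 c.2).@[point_AB x] in
    `|y| < M.@[point_AB x] <= `|y| + eta.
  have [b bP] := cons_bounded eps_ge0 (closed_loop v S c.1 c.2) archP.
  have [M MP] := mpoly_abs_majorant (closed_loop v S c.1 c.2) b eta0.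
  by exists M => x cx; apply/MP/bP.
(* After scaling, the remaining margin [a e / 2] is [2 delta], which exceeds the required
   [delta]. *)
pose a := 4 * delta / e; have a0 : 0 < a by rewrite divr_gt0 ?mulr_gt0.
pose N : 'M[{mpoly R[dimAB n m]}]_n := \matrix_(i, j) (a%:MP * M (i, j)).
have closed_loopZ i j x : (closed_loop (a *: v) (a *: S) i j).@[point_AB x] =
    a * (closed_loop v S i j).@[point_AB x :> (_ -> R)].
  rewrite !closed_loop_meval mulrDr mulr_sumr !mxE; congr (_ + _); first ring.
  by apply: eq_bigr => l _; rewrite !mxE; ring.
have N_bounds i j x :
    consistent_ext eps xh u (point_A x) (point_B x) (point_Dx x) ->
    `|(closed_loop (a *: v) (a *: S) i j).@[point_AB x]| < (N i j).@[point_AB x]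
    <= a * (`|(closed_loop v S i j).@[point_AB x]| + eta).
  move=> cx; have /andP[h1 h2] := MP (i, j) x cx.
  by rewrite closed_loopZ mxE mevalM mevalC normrM gtr0_norm // ltr_pM2l //
    ler_pM2l // h1.
have row_pos i : exists d0, forall d, (d0 <= d)%N ->
    Sigma_cons_le eps xh u d
      (embed_AB T (((a *: v) 0 i)%:MP - delta%:MP - \sum_j N i j)).
  apply: Sigma_cons_positive => // x cx.
  rewrite 2!mevalB !mevalC (raddf_sum (meval _)) mxE.
  have : \sum_j (N i j).@[point_AB x] <= a * (v 0 i - e + n%:R * eta).
    apply: (@le_trans _ _ (\sum_j
      a * (`|(closed_loop v S i j).@[point_AB x]| + eta))).
      by apply: ler_sum => j _; have /andP[] := N_bounds i j x cx.
    rewrite -mulr_sumr ler_pM2l // big_split /= sumr_const card_ord.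
    by rewrite -[eta *+ n]mulr_natl lerD2r margin.
  have -> : n%:R * eta = e / 2 by rewrite /eta; field; rewrite gt_eqF.
  have : a * e = 4 * delta by rewrite /a divfK // gt_eqF.
  rewrite mulrDr mulrBr => ae Nle; rewrite subr_gt0.
  apply: le_lt_trans Nle _; nra.
(* The majorant is strict, so both signed differences are positive, as Putinar's theorem
   requires. *)
have add_pos i j : exists d0, forall d, (d0 <= d)%N ->
    Sigma_cons_le eps xh u d
      (embed_AB T (N i j + closed_loop (a *: v) (a *: S) i j)).
  apply: Sigma_cons_positive => // x cx; rewrite mevalD.
  have /andP[] := N_bounds i j x cx.
  by rewrite ltr_norml => /andP[? _] _; lra.
have sub_pos i j : exists d0, forall d, (d0 <= d)%N ->
    Sigma_cons_le eps xh u d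
      (embed_AB T (N i j - closed_loop (a *: v) (a *: S) i j)).
  apply: Sigma_cons_positive => // x cx; rewrite mevalB.
  have /andP[] := N_bounds i j x cx.
  by rewrite ltr_norml => /andP[_ ?] _; lra.
have [d1 row_d1] := uniform_threshold row_pos.
have [d2 add_d2] :=
  uniform_threshold (fun i => uniform_threshold (add_pos i)).
have [d3 sub_d3] :=
  uniform_threshold (fun i => uniform_threshold (sub_pos i)).
have deg_N i j : exists d0, forall d, (d0 <= d)%N -> mdeg_le d (N i j).
  by exists (msize (N i j)) => d; apply: leqW.
have [d4 deg_d4] := uniform_threshold (fun i => uniform_threshold (deg_N i)).
exists (maxn (maxn d1 d2) (maxn d3 d4)) => d.
rewrite !geq_max => /andP[/andP[le1 le2] /andP[le3 le4]].
(* The thresholds concern the degree bound itself, which is [2d] in the program. *)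
have le2d k : (k <= d)%N -> (k <= 2 * d)%N.
  by move=> /leq_trans; apply; rewrite leq_pmull.
exists (a *: v), (a *: S), N; split.
- by move=> i; rewrite mxE mulr_gt0.
- exact/deg_d4/le2d.
- exact/row_d1/le2d.
- exact/add_d2/le2d.
- exact/sub_d3/le2d.
Qed.
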